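(* There are two median graphs $G^*$ and $H^*$ of dimension 2 such that 2-SWEEP does not return the diameter on $G^*$ and 4-SWEEP does not return the diameter on $H^*$; that is, there is an execution of 2-SWEEP on $G^*$ (a valid choice of the start vertex and of the farthest vertices) returning a value different from $\mathrm{diam}(G^* )$, and there is an execution of 4-SWEEP on $H^*$ returning a value different from $\mathrm{diam}(H^* )$.
   Context: All graphs are finite, simple, undirected, unweighted and connected; $d(u,v)$ is the shortest-path distance and $I(u,v)=\{x: d(u,x)+d(x,v)=d(u,v)\}$. A graph is median if for every triple $x,y,z$ the set $I(x,y)\cap I(y,z)\cap I(z,x)$ contains exactly one vertex; its dimension is the largest $k$ such that it contains an induced copy of the hypercube $Q_k$. $\mathrm{diam}(G)=\max_{u,v}d(u,v)$. The heuristic 2-SWEEP picks an arbitrary vertex $r_1$, a vertex $a_1$ maximizing $d(r_1,\cdot)$, then a vertex $b_1$ maximizing $d(a_1,\cdot)$, and returns $d(a_1,b_1)$. The heuristic 4-SWEEP runs 2-SWEEP to get $a_1,b_1$, takes $r_2$ to be a middle vertex of a shortest $(a_1,b_1)$-path, runs 2-SWEEP again from $r_2$ obtaining $a_2,b_2$, and returns $d(a_2,b_2)$. *)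

(* Defs.v *)
From mathcomp Require Import all_boot.

Set Implicit Arguments.
Unset Strict Implicit.
Unset Printing Implicit Defensive.

Record graph := Graph {
  vertex :> finType;
  edge : rel vertex;
  edge_sym : symmetric edge;
  edge_irr : irreflexive edge;
  graph_connected : forall u v : vertex, connect edge u v
}.

(* In the library's convention a walk from u is u :: p with path (edge G) u p; *)
(* its length, the number of edges, is size p.                                 *)
Definition walk_of_length (G : graph) (u v : G) (n : nat) : bool :=
  [exists p : n.-tuple G, path (@edge G) u p && (last u p == v)].

(* The least n with a walk of length n from u to v; the search can be cut at   *)
(* #|G| because G is connected and simple paths have fewer than #|G| edges.    *)
Definition dist (G : graph) (u v : G) : nat :=
  find (walk_of_length u v) (iota 0 #|G|).

Definition interval (G : graph) (u v : G) : {set G} :=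
  [set x | dist u x + dist x v == dist u v].

Definition median_graph (G : graph) : Prop :=
  forall x y z : G,
    #|interval x y :&: interval y z :&: interval z x| = 1.

Definition cube (k : nat) := {ffun 'I_k -> bool}.

Definition cube_edge (k : nat) : rel (cube k) :=
  fun s t => #|[set i | s i != t i]| == 1.

Definition has_induced_cube (G : graph) (k : nat) : Prop :=
  exists2 f : cube k -> G,
    injective f & forall s t, edge (f s) (f t) = cube_edge s t.

Definition has_dimension (G : graph) (k : nat) : Prop :=
  has_induced_cube G k /\ forall j, has_induced_cube G j -> j <= k.

Definition diam (G : graph) : nat := \max_(u : G) \max_(v : G) dist u v.

Definition farthest (G : graph) (u v : G) : Prop :=
  forall x : G, dist u x <= dist u v.

Definition shortest_path (G : graph) (u v : G) (p : seq G) : Prop :=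
  [/\ path (@edge G) u p, last u p = v & size p = dist u v].

(* A path with an odd number of edges has two middle vertices, both allowed.   *)
Definition middle_vertex (G : graph) (u v r : G) : Prop :=
  exists2 p : seq G, shortest_path u v p &
    r = nth u (u :: p) (size p)./2 \/ r = nth u (u :: p) (uphalf (size p)).

(* The algorithms make arbitrary choices, so their executions are relations.   *)
Definition two_sweep_run (G : graph) (r a b : G) : Prop :=
  farthest r a /\ farthest a b.

Definition two_sweep_returns (G : graph) (n : nat) : Prop :=
  exists r1 a1 b1 : G, two_sweep_run r1 a1 b1 /\ n = dist a1 b1.

Definition four_sweep_returns (G : graph) (n : nat) : Prop :=
  exists r1 a1 b1 r2 a2 b2 : G,
    [/\ two_sweep_run r1 a1 b1, middle_vertex a1 b1 r2,
        two_sweep_run r2 a2 b2 & n = dist a2 b2].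

(* Main.v *)
Require Import Defs.
From mathcomp Require Import all_boot.

(* A single graph defeats both heuristics: the 4-cycle 0-1-2-3 with a pendant  *)
(* vertex 4 attached to 2. Its diameter is d(0,4) = 3, but the farthest        *)
(* vertices from 1 include 3, whose eccentricity is only 2; so 2-SWEEP started *)
(* at 1 may return d(3,1) = 2. Moreover 4-SWEEP can be led to restart from 1:  *)
(* from 2 it may go to 0, then to 4, and 1 is a middle vertex of the path      *)
(* 0-1-2-4. It has too few vertices to contain a 3-cube.                       *)

(** Everything becomes a finite check on five vertices once [dist], a search over walks, is replaced
    by a closed formula. [dist_characterization] allows this, and [kite_distE] applies it to the
    grid distance. *)

(** [D] drops by at most one along an edge, so it bounds walk lengths from below; stepping to a
    neighbour where it drops by exactly one attains the bound. *)
Lemma dist_characterization (G : graph) (D : G -> G -> nat) :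
    (forall v, D v v = 0) ->
    (forall u w v, edge u w -> D u v <= (D w v).+1) ->
    (forall u v, u != v -> exists2 w, edge u w & D u v = (D w v).+1) ->
  forall u v, dist u v = D u v.
Proof.
move=> D0 Dedge Dstep u v.
have Dwalk p x : path (@edge G) x p -> D x (last x p) <= size p.
  elim: p x => [|y p IHp] x /=; first by rewrite D0.
  by case/andP=> xy /IHp yp; apply: leq_trans (Dedge _ _ _ xy) _.
have Dpath n x : D x v = n ->
    exists p, [/\ path (@edge G) x p, last x p = v & size p = n].
  elim: n x => [|n IHn] x Dx; have [xv|xv] := eqVneq x v.
  - by exists [::].
  - by have [w _] := Dstep _ _ xv; rewrite Dx.
  - by move: Dx; rewrite xv D0.
  have [w xw] := Dstep _ _ xv; rewrite Dx => -[/esym/IHn[p [wp lp sp]]].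
  by exists (w :: p); split; rewrite /= ?xw ?sp.
have [p [up lp sp]] := Dpath _ u erefl.
have walkD : walk_of_length u v (D u v).
  apply/existsP; have sp' : size p == D u v by apply/eqP.
  by exists (Tuple sp'); rewrite /= up lp /=.
(* The search cut at [#|G|] reaches [D u v], because a simple path has fewer than [#|G|] edges. *)
have D_lt : D u v < #|G|.
  rewrite -lp; case: (shortenP up) => q uq Uq _.
  apply: leq_ltn_trans (Dwalk _ _ uq) _.
  by rewrite -[(size q).+1]/(size (u :: q)) -(card_uniqP Uq) max_card.
have no_walk i : i < D u v -> walk_of_length u v i = false.
  move=> lt_i; apply/existsP=> -[q /andP[/Dwalk uq /eqP lq]].
  by move: uq; rewrite lq size_tuple leqNgt lt_i.
rewrite /dist -(subnKC (ltnW D_lt)) iotaD find_cat size_iota add0n.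
case: hasP => [[i]|_].
  by rewrite mem_iota add0n => /andP[_ /no_walk->].
by move: D_lt; rewrite -subn_gt0; case: (_ - _) => // k _; rewrite /= walkD addn0.
Qed.

(* The graph is isometric to its drawing in the grid Z^2, with 0, 1, 2, 3, 4   *)
(* at (0,0), (1,0), (1,1), (0,1), (2,1).                                       *)
Definition kite_dist (x y : 'I_5) : nat :=
  let l1 (a b : nat) := (a - b) + (b - a) in
  l1 (nth 0 [:: 0; 1; 1; 0; 2] x) (nth 0 [:: 0; 1; 1; 0; 2] y) +
  l1 (nth 0 [:: 0; 0; 1; 1; 1] x) (nth 0 [:: 0; 0; 1; 1; 1] y).

Definition kite_edge : rel 'I_5 := fun x y => kite_dist x y == 1.

Lemma kite_sym : symmetric kite_edge.
Proof. by do 2![case=> [[|[|[|[|[|//]]]]] ?]]. Qed.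

Lemma kite_irr : irreflexive kite_edge.
Proof. by case=> [[|[|[|[|[|//]]]]] ?]. Qed.

(** This descent yields both connectedness and the last hypothesis of [dist_characterization]. *)
Lemma kite_step (u v : 'I_5) :
  u != v -> exists2 w, kite_edge u w & kite_dist u v = (kite_dist w v).+1.
Proof.
move=> uv; suff [k kP] : exists k,
    kite_edge u (inord k) && (kite_dist u v == (kite_dist (inord k) v).+1).
  by exists (inord k); case/andP: kP => // _ /eqP.
move: u v uv; rewrite /kite_edge /kite_dist.
by do 2![case=> [[|[|[|[|[|//]]]]] ?]] => // _;
  do [ by exists 0; rewrite inordK | by exists 1; rewrite inordK
     | by exists 2; rewrite inordK | by exists 3; rewrite inordK
     | by exists 4; rewrite inordK ].
Qed.

Lemma kite_connected u v : connect kite_edge u v.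
Proof.
have [n] := ubnP (kite_dist u v); elim: n u => // n IHn u; rewrite ltnS.
have [->|/kite_step[w uw ->]] := eqVneq u v; first by rewrite connect0.
by move=> /IHn; apply/connect_trans/connect1.
Qed.

Definition kite : graph := Graph kite_sym kite_irr kite_connected.

Lemma kite_distE (u v : kite) : dist u v = kite_dist u v.
Proof.
apply: (dist_characterization kite kite_dist) => [|{u v}u w v|{u v}].
- by case=> [[|[|[|[|[|//]]]]] ?].
- by rewrite /= /kite_edge; move: u w v;
    do 3![case=> [[|[|[|[|[|//]]]]] ?]].
- exact: kite_step.
Qed.

Lemma kite_median : median_graph kite.
Proof.
move=> x y z; rewrite -sum1_card big_mkcond /=.
under eq_bigr => i _ do rewrite !inE !kite_distE.
rewrite !big_ord_recl big_ord0; move: x y z.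
by do 3![case=> [[|[|[|[|[|//]]]]] ?]].
Qed.

Lemma kite_dimension : has_dimension kite 2.
Proof.
split; last first.
  (* Injectivity gives [2 ^ j <= 5 < 2 ^ 3]. *)
  move=> j [f f_inj _]; have := leq_card f f_inj.
  rewrite card_ffun card_bool !card_ord => le5.
  by rewrite -ltnS -(ltn_exp2l _ _ (isT : 1 < 2)) (leq_ltn_trans le5).
(* The two bits are the grid coordinates, so the image is the 4-cycle. *)
pose k (s : cube 2) := if s ord0 then 1 + s ord_max else 3 * s ord_max.
pose f (s : cube 2) : kite := inord (k s).
have fE s : f s = k s :> nat.
  by rewrite inordK // /k; case: (s _); case: (s _).
exists f => [s t /(congr1 val)|s t].
  rewrite /= !fE /k => st; apply/ffunP=> i.
  have : s ord0 = t ord0 /\ s ord_max = t ord_max.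
    by move: st; case: (s ord0); case: (s ord_max); case: (t ord0);
      case: (t ord_max).
  case=> s0 s1; case: i => [[|[|//]] i_lt].
    by rewrite (_ : Ordinal i_lt = ord0) //; apply: val_inj.
  by rewrite (_ : Ordinal i_lt = ord_max) //; apply: val_inj.
rewrite /cube_edge -sum1_card big_mkcond /= !big_ord_recl big_ord0 !inE.
rewrite /= /kite_edge /kite_dist !fE /k.
have -> : lift ord0 ord0 = ord_max :> 'I_2 by apply: val_inj.
by case: (s ord0); case: (s ord_max); case: (t ord0); case: (t ord_max).
Qed.

Lemma kite_diam : diam kite != 2.
Proof.
(* The pair 0, 4 at distance 3 pushes the maximum above 2. *)
rewrite neq_ltn orbC /diam (bigD1 (inord 0 : kite)) //= leq_max.
rewrite (bigD1 (inord 4 : kite)) //= leq_max kite_distE.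
by rewrite /kite_dist !inordK.
Qed.

Lemma kite_farthest (u v : kite) :
  (forall x : 'I_5, kite_dist u x <= kite_dist u v) -> farthest u v.
Proof. by move=> uv x; rewrite !kite_distE. Qed.

Lemma kite_two_sweep : two_sweep_run (inord 1 : kite) (inord 3) (inord 1).
Proof.
by split; apply: kite_farthest; case=> [[|[|[|[|[|//]]]]] ?];
  rewrite /kite_dist !inordK.
Qed.

Lemma dist_3_1 : dist (inord 3 : kite) (inord 1) = 2.
Proof. by rewrite kite_distE /kite_dist !inordK. Qed.

Theorem theorem1 :
  exists G H : graph,
    [/\ median_graph G /\ has_dimension G 2,
        median_graph H /\ has_dimension H 2,
        exists n : nat, two_sweep_returns G n /\ n <> diam G
      & exists n : nat, four_sweep_returns H n /\ n <> diam H].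
Proof.
have n2 : 2 <> diam kite by apply/nesym/eqP/kite_diam.
have med_dim := conj kite_median kite_dimension.
exists kite, kite; split=> //; exists 2; split=> //.
  by exists (inord 1), (inord 3), (inord 1); rewrite dist_3_1; split=> //;
    apply: kite_two_sweep.
exists (inord 2), (inord 0), (inord 4), (inord 1), (inord 3), (inord 1).
split; last by rewrite dist_3_1.
- by split; apply: kite_farthest; case=> [[|[|[|[|[|//]]]]] ?];
    rewrite /kite_dist !inordK.
(* With three edges, the lower middle has index 1, which is vertex 1. *)
- exists [:: inord 1; inord 2; inord 4]; last by left.
  by split; rewrite //= ?kite_distE /kite_edge /kite_dist !inordK.
- exact: kite_two_sweep.
Qed.
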